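(* Let $G$ be a graph and $\mathcal T$ a tangle in $G$ of order $t$. Let $k$ and $w$ be positive integers with $t \ge (k+w)^{k+1}+k$. Let $\{X_j \subseteq V(G): j\in J\}$ be a family of subsets of $V(G)$ indexed by a set $J$, with $|X_j|=k$ for all $j\in J$. Then there exists a set $J'\subseteq J$ such that (1) $X_j\cap X_{j'}=\emptyset$ for all distinct $j,j'\in J'$, (2) $X=\bigcup_{j\in J'}X_j$ is free with respect to $\mathcal T$, and (3) if $|X|<w$, then there exists a set $Z\subseteq V(G)$ with $X\subseteq Z$ and $|Z|\le (w+k)^{k+1}$ such that for every $j\in J$, either $X_j\cap Z\ne\emptyset$ or $X_j$ is not free with respect to $\mathcal T - Z$.
   Context: A separation of a graph $G$ is an ordered pair $(A,B)$ of edge-disjoint subgraphs of $G$ with $A\cup B=G$; its order is $|V(A)\cap V(B)|$. A tangle of order $\Theta$ in $G$ is a set $\mathcal T$ of separations of $G$, each of order $<\Theta$, such that: (i) for every separation $(A,B)$ of order $<\Theta$, one of $(A,B)$, $(B,A)$ belongs to $\mathcal T$; (ii) if $(A_1,B_1),(A_2,B_2),(A_3,B_3)\in\mathcal T$ then $A_1\cup A_2\cup A_3\ne G$; (iii) if $(A,B)\in\mathcal T$ then $V(A)\ne V(G)$. A set $X\subseteq V(G)$ is free with respect to $\mathcal T$ if there is no $(A,B)\in\mathcal T$ of order strictly less than $|X|$ with $X\subseteq V(A)$. For $Z\subseteq V(G)$, $\mathcal T-Z$ is the set of separations $(A',B')$ of $G-Z$ for which there is $(A,B)\in\mathcal T$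 with $Z\subseteq V(A)\cap V(B)$, $A-Z=A'$ and $B-Z=B'$. *)

(* Defs.v *)
From HB Require Import structures.
From mathcomp Require Import all_boot.
From mathcomp Require Import boolp.

Set Implicit Arguments.
Unset Strict Implicit.
Unset Printing Implicit Defensive.

(* Finite graphs; loops (#|ends e| = 1) and parallel edges are allowed. *)
Record graph := Graph {
  vertex : finType;
  edge : finType;
  ends : edge -> {set vertex};
  endsP : forall e, 0 < #|ends e| <= 2 }.

Arguments ends {g} e.

Definition incidence_closed (G : graph) (H : {set vertex G} * {set edge G}) :=
  [forall e in H.2, ends e \subset H.1].

(* The closure condition is boolean, so equality of subgraphs amounts to
   equality of their vertex sets and of their edge sets. *)
Record subgraph (G : graph) := Subgraph {
  subgraph_val :> {set vertex G} * {set edge G};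
  subgraphP : incidence_closed subgraph_val }.

HB.instance Definition _ (G : graph) := [isSub for @subgraph_val G].
HB.instance Definition _ (G : graph) := [Finite of subgraph G by <:].

Section Subgraphs.
Variable G : graph.
Implicit Types (A B H : subgraph G) (X Z : {set vertex G}).
Implicit Types T : {set subgraph G * subgraph G}.

Definition vset H : {set vertex G} := (subgraph_val H).1.
Definition eset H : {set edge G} := (subgraph_val H).2.

Lemma ends_sub H e : e \in eset H -> ends e \subset vset H.
Proof. by move=> eH; have /forall_inP := subgraphP H; apply. Qed.

Fact whole_closed : incidence_closed (G := G) (setT, setT).
Proof. by apply/forall_inP => e _; apply: subsetT. Qed.

Definition whole : subgraph G := Subgraph whole_closed.

Fact gunion_closed A B :
  incidence_closed (vset A :|: vset B, eset A :|: eset B).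
Proof.
apply/forall_inP => e /setUP[] /ends_sub eH; apply: subset_trans eH _.
  exact: subsetUl.
exact: subsetUr.
Qed.

Definition gunion A B : subgraph G := Subgraph (gunion_closed A B).

Fact gdel_closed H Z :
  incidence_closed
    (vset H :\: Z, [set e in eset H | [disjoint ends e & Z]]).
Proof.
apply/forall_inP => e; rewrite inE => /andP[/ends_sub eH eZ].
by rewrite subsetD eH.
Qed.

Definition gdel H Z : subgraph G := Subgraph (gdel_closed H Z).

Definition separation H (S : subgraph G * subgraph G) : bool :=
  (gunion S.1 S.2 == H) && [disjoint eset S.1 & eset S.2].

Definition order (S : subgraph G * subgraph G) : nat :=
  #|vset S.1 :&: vset S.2|.

Record tangle H (theta : nat) T : Prop := Tangle {
  tangle_sep : forall S, S \in T -> separation H S /\ order S < theta;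
  tangle_total : forall A B, separation H (A, B) -> order (A, B) < theta ->
    (A, B) \in T \/ (B, A) \in T;
  tangle_cover3 : forall S1 S2 S3, S1 \in T -> S2 \in T -> S3 \in T ->
    gunion (gunion S1.1 S2.1) S3.1 <> H;
  tangle_vset : forall S, S \in T -> vset S.1 <> vset H }.

Definition free_wrt T X : Prop :=
  ~ exists S, [/\ S \in T, order S < #|X| & X \subset vset S.1].

Definition tangle_del H T Z : {set subgraph G * subgraph G} :=
  [set S' | separation (gdel H Z) S' &
    [exists S in T, [&& Z \subset vset S.1 :&: vset S.2,
                        gdel S.1 Z == S'.1 & gdel S.2 Z == S'.2]]].

(* The index type may be infinite, hence the classical comprehension. *)
Definition family_union (J : Type) (X : J -> {set vertex G}) (J' : J -> Prop) :
    {set vertex G} :=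
  [set v | `[< exists2 j, J' j & v \in X j >]].

End Subgraphs.

Arguments whole G : clear implicits.

(* Main.v *)
From mathcomp Require Import all_boot.
From mathcomp Require Import boolp zify.
Require Import Defs.

Set Implicit Arguments.
Unset Strict Implicit.
Unset Printing Implicit Defensive.

(** Let [r W] be the least order of a member of the tangle whose small side
    contains [W] (capped at the order of the tangle).  This is the rank function
    of a matroid in which a set of size less than [t] is independent iff it is
    free.

    Take [J'] with [X] as large as possible.  If [|X| < w], every [X_j] disjoint
    from [X] satisfies [r (X :|: X_j) <= r X + (k - 1)].  It then suffices to find
    a small [Z] such that every [Y] with [r (W :|: Y) <= r W + d] lies in the small
    side of a member of the tangle having at most [d] boundary vertices outside
    [Z].  This is done by induction on [d].  Let [F] be a member of order [r W]
    with [W] in its small side and with large side as small as possible, and put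
    its boundary into [Z].  Each [Y] has an optimal separation [S] beyond [F].  If
    the boundary of [F] stays in the large side of [S], then [S] is as wanted.
    Otherwise some [z] of the boundary is lost.  If two separations lose the same
    [z], their meet has order greater than [r W] by the choice of [F], so by
    submodularity the second one has smaller rank over the first.  Hence adding to
    [W], for each [z], one separation that loses [z] lowers [d] for all remaining
    [Y]. *)

(** * Lattice operations on separations and their orders *)

Section SeparationAlgebra.
Variable G : graph.
Implicit Types (A B H : subgraph G) (S : subgraph G * subgraph G).
Implicit Types (W Y Z : {set vertex G}).

Lemma subgraph_eq A B : vset A = vset B -> eset A = eset B -> A = B.
Proof.
rewrite /vset /eset => eV eE; apply: val_inj.
by rewrite /= [subgraph_val A]surjective_pairing eV eE -surjective_pairing.
Qed.

Lemma separationP H S :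
  reflect [/\ vset S.1 :|: vset S.2 = vset H, eset S.1 :|: eset S.2 = eset H
            & [disjoint eset S.1 & eset S.2]] (separation H S).
Proof.
apply: (iffP andP) => [[/eqP <-]|[eV eE dE]] //.
by split=> //; apply/eqP/subgraph_eq.
Qed.

Fact ginter_closed A B :
  incidence_closed (vset A :&: vset B, eset A :&: eset B).
Proof.
apply/forall_inP => e /setIP[/ends_sub eA /ends_sub eB].
by rewrite subsetI eA.
Qed.

Definition ginter A B : subgraph G := Subgraph (ginter_closed A B).

Fact gaddv_closed A Z : incidence_closed (vset A :|: Z, eset A).
Proof.
apply/forall_inP => e /ends_sub eA.
exact: subset_trans eA (subsetUl _ _).
Qed.

Definition gaddv A Z : subgraph G := Subgraph (gaddv_closed A Z).

Fact gdiscrete_closed Z : incidence_closed (Z, set0 : {set edge G}).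
Proof. by apply/forall_inP => e; rewrite inE. Qed.

Definition gdiscrete Z : subgraph G := Subgraph (gdiscrete_closed Z).

Definition sep_join S S' := (gunion S.1 S'.1, ginter S.2 S'.2).
Definition sep_meet S S' := (ginter S.1 S'.1, gunion S.2 S'.2).
(** Enlarging both sides puts [Z] into the boundary, as membership in [tangle_del] demands. *)
Definition sep_add S Z := (gaddv S.1 Z, gaddv S.2 Z).

Lemma separation_join S S' :
  separation (whole G) S -> separation (whole G) S' ->
  separation (whole G) (sep_join S S').
Proof.
move=> /separationP[v1 e1 d1] /separationP[v2 e2 d2].
apply/separationP; split; rewrite /=.
- apply/setP => x; move/setP/(_ x): v1; move/setP/(_ x): v2; rewrite !inE.
  by do 4!case: (_ \in _).
- apply/setP => x; move/setP/(_ x): e1; move/setP/(_ x): e2; rewrite !inE.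
  by do 4!case: (_ \in _).
- rewrite -setI_eq0 in d1; rewrite -setI_eq0 in d2; rewrite -setI_eq0.
  apply/eqP/setP => x; move/eqP/setP/(_ x): d1; move/eqP/setP/(_ x): d2.
  by rewrite !inE; do 4!case: (_ \in _).
Qed.

Lemma separation_swap S :
  separation (whole G) S -> separation (whole G) (S.2, S.1).
Proof.
move=> /separationP[v e d]; apply/separationP.
by split; rewrite /= 1?setUC // disjoint_sym.
Qed.

Lemma separation_meet S S' :
  separation (whole G) S -> separation (whole G) S' ->
  separation (whole G) (sep_meet S S').
Proof.
move=> sS sS'.
exact: (separation_swap
  (separation_join (separation_swap sS) (separation_swap sS'))).
Qed.

Lemma separation_add S Z :
  separation (whole G) S -> separation (whole G) (sep_add S Z).
Proof.
move=> /separationP[v e d]; apply/separationP; split=> //=.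
by rewrite setUACA v setUid setTU.
Qed.

Lemma card_separation S : separation (whole G) S ->
  order S + #|vertex G| = #|vset S.1| + #|vset S.2|.
Proof. by move=> /separationP[v _ _]; rewrite -cardsT -cardsUI v addnC. Qed.

(** An equality, because the order is the sum of the sizes of the two vertex sides minus the size of
    the graph, and cardinality is modular on each side. *)
Lemma order_modular S S' :
  separation (whole G) S -> separation (whole G) S' ->
  order (sep_join S S') + order (sep_meet S S') = order S + order S'.
Proof.
move=> sS sS'.
have jE : order (sep_join S S') + #|vertex G| =
    #|vset S.1 :|: vset S'.1| + #|vset S.2 :&: vset S'.2|.
  exact: card_separation (separation_join sS sS').
have mE : order (sep_meet S S') + #|vertex G| =
    #|vset S.1 :&: vset S'.1| + #|vset S.2 :|: vset S'.2|.
  exact: card_separation (separation_meet sS sS').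
have := card_separation sS; have := card_separation sS'.
have := cardsUI (vset S.1) (vset S'.1).
have := cardsUI (vset S.2) (vset S'.2).
lia.
Qed.

Lemma order_add S Z :
  order (sep_add S Z) = #|Z| + #|vset S.1 :&: vset S.2 :\: Z|.
Proof.
rewrite /order /= -setUIl setUC -[in LHS](setID (Z :|: _) Z).
rewrite cardsU [X in _ - X](_ : _ = 0); last first.
  by apply/eqP; rewrite cards_eq0; apply/eqP/setP => x; rewrite !inE;
     do 3!case: (_ \in _).
by rewrite subn0 setUK setDUl setDv set0U.
Qed.

End SeparationAlgebra.

(** * Closure of a tangle under join, meet and added vertices *)

Section TangleRank.
Variables (G : graph) (t : nat) (T : {set subgraph G * subgraph G}).
Hypothesis hT : tangle (whole G) t T.
Implicit Types (F S : subgraph G * subgraph G) (W Y Z : {set vertex G}).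

(** Otherwise the reverse of [S] is in the tangle, and its small side covers the graph together with
    those of [S1] and [S2]. *)
Lemma tangle_orient S S1 S2 :
  separation (whole G) S -> order S < t -> S1 \in T -> S2 \in T ->
  gunion (gunion S.2 S1.1) S2.1 = whole G -> S \in T.
Proof.
case: S => A B sS oS S1T S2T cov.
have [//|BAT] := tangle_total hT sS oS.
by have := tangle_cover3 hT BAT S1T S2T; rewrite cov.
Qed.

Lemma tangle_join S S' : S \in T -> S' \in T ->
  order (sep_join S S') < t -> sep_join S S' \in T.
Proof.
move=> ST S'T o; have [sS _] := tangle_sep hT ST.
have [sS' _] := tangle_sep hT S'T.
apply: (tangle_orient _ o ST S'T); first exact: separation_join.
case/separationP: sS => v1 e1 _; case/separationP: sS' => v2 e2 _.
apply: subgraph_eq; rewrite /=; apply/setP => x.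
  move/setP/(_ x): v1; move/setP/(_ x): v2; rewrite !inE.
  by do 4!case: (_ \in _).
move/setP/(_ x): e1; move/setP/(_ x): e2; rewrite !inE.
by do 4!case: (_ \in _).
Qed.

Lemma tangle_meet S S' : S \in T -> S' \in T ->
  order (sep_meet S S') < t -> sep_meet S S' \in T.
Proof.
move=> ST S'T o; have [sS _] := tangle_sep hT ST.
have [sS' _] := tangle_sep hT S'T.
apply: (tangle_orient _ o ST S'T); first exact: separation_meet.
case/separationP: sS => v1 e1 _; case/separationP: sS' => v2 e2 _.
apply: subgraph_eq; rewrite /=; apply/setP => x.
  move/setP/(_ x): v1; move/setP/(_ x): v2; rewrite !inE.
  by do 4!case: (_ \in _).
move/setP/(_ x): e1; move/setP/(_ x): e2; rewrite !inE.
by do 4!case: (_ \in _).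
Qed.

Lemma tangle_add S Z : S \in T ->
  order (sep_add S Z) < t -> sep_add S Z \in T.
Proof.
move=> ST o; have [sS _] := tangle_sep hT ST.
apply: (tangle_orient _ o ST ST); first exact: separation_add.
case/separationP: sS => v e _.
apply: subgraph_eq; rewrite /=; apply/setP => x.
  move/setP/(_ x): v; rewrite !inE.
  by do 3!case: (_ \in _).
move/setP/(_ x): e; rewrite !inE.
by do 2!case: (_ \in _).
Qed.

Lemma tangle_discrete W : #|W| < t -> (gdiscrete W, whole G) \in T.
Proof.
move=> Wt.
have sS : separation (whole G) (gdiscrete W, whole G).
  apply/separationP; split; rewrite /= ?setUT //.
  by rewrite -setI_eq0 set0I.
have oS : order (gdiscrete W, whole G) < t by rewrite /order setIT.
have [//|/(tangle_vset hT)] := tangle_total hT sS oS.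
by [].
Qed.

(** * The rank function of a tangle *)

Definition rank_le W n :=
  (t <= n) || [exists S in T, (W \subset vset S.1) && (order S <= n)].

Fact rank_le_ex W : exists n, rank_le W n.
Proof. by exists t; rewrite /rank_le leqnn. Qed.

Definition rank W := ex_minn (rank_le_ex W).

Lemma rankP W n : reflect
  (t <= n \/ exists S, [/\ S \in T, W \subset vset S.1 & order S <= n])
  (rank W <= n).
Proof.
have -> : (rank W <= n) = rank_le W n.
  rewrite /rank; case: ex_minnP => m Pm minm.
  apply/idP/idP => [mn|/minm //].
  case/orP: Pm => [tm|/exists_inP[S ST /andP[WS om]]]; apply/orP.
    by left; apply: leq_trans mn.
  by right; apply/exists_inP; exists S; rewrite // WS (leq_trans om).
apply: (iffP orP) => -[|H]; first by left.
- by case/exists_inP: H => S ST /andP[WS om]; right; exists S.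
- by left.
- by case: H => S [ST WS om]; right; apply/exists_inP; exists S; rewrite // WS.
Qed.

Lemma rank_le_order S W : S \in T -> W \subset vset S.1 -> rank W <= order S.
Proof. by move=> ST WS; apply/rankP; right; exists S. Qed.

Lemma rank_le_tangle_order W : rank W <= t.
Proof. by apply/rankP; left. Qed.

Lemma rank_attained W : rank W < t ->
  exists S, [/\ S \in T, W \subset vset S.1 & order S = rank W].
Proof.
move=> rt; have /rankP[|[S [ST WS oS]]] := leqnn (rank W); first lia.
exists S; split=> //; apply/eqP; rewrite eqn_leq oS.
exact: rank_le_order.
Qed.

Lemma rank_mono W Y : W \subset Y -> rank W <= rank Y.
Proof.
move=> WY; have /rankP[tr|[S [ST YS oS]]] := leqnn (rank Y).
  by apply/rankP; left.
by apply/rankP; right; exists S; split=> //; apply: subset_trans YS.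
Qed.

Lemma rank_le_card W : rank W <= #|W|.
Proof.
have [tW|Wt] := leqP t #|W|; first by apply/rankP; left.
apply: leq_trans (rank_le_order (tangle_discrete Wt) (subxx _)) _.
by rewrite /order setIT.
Qed.

(** No bound on the order of the join is assumed: once it reaches [t], the cap on [rank] settles the
    claim. *)
Lemma rank_le_join S S' W : S \in T -> S' \in T ->
  W \subset vset S.1 :|: vset S'.1 -> rank W <= order (sep_join S S').
Proof.
move=> ST S'T Wsub; have [to|ot] := leqP t (order (sep_join S S')).
  by apply/rankP; left.
exact: rank_le_order (tangle_join ST S'T ot) Wsub.
Qed.

Lemma rank_le_meet S S' W : S \in T -> S' \in T ->
  W \subset vset S.1 :&: vset S'.1 -> rank W <= order (sep_meet S S').
Proof.
move=> ST S'T Wsub; have [to|ot] := leqP t (order (sep_meet S S')).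
  by apply/rankP; left.
exact: rank_le_order (tangle_meet ST S'T ot) Wsub.
Qed.

Lemma rank_submodular W Y :
  rank (W :|: Y) + rank (W :&: Y) <= rank W + rank Y.
Proof.
have := rank_le_tangle_order (W :|: Y).
have [tW|Wt] := leqP t (rank W).
  by have := rank_mono (subsetIr W Y); lia.
have [tY|Yt] := leqP t (rank Y).
  by have := rank_mono (subsetIl W Y); lia.
have [S [ST WS <-]] := rank_attained Wt.
have [S' [S'T YS' <-]] := rank_attained Yt.
have [sS _] := tangle_sep hT ST; have [sS' _] := tangle_sep hT S'T.
rewrite -order_modular // => _; apply: leq_add.
  by apply: rank_le_join => //; apply: setUSS.
by apply: rank_le_meet => //; apply: setISS.
Qed.

(** Any two of the sets [W :|: Y i] meet in a superset of [W], so by submodularity the excesses over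
    [rank W] add up. *)
Lemma rank_bigcup W (I : Type) (s : seq I) (Y : I -> {set vertex G}) d :
  (forall i, rank (W :|: Y i) <= rank W + d) ->
  rank (W :|: \bigcup_(i <- s) Y i) <= rank W + size s * d.
Proof.
move=> hY; elim: s => [|i s IH]; first by rewrite big_nil setU0 addn0.
rewrite big_cons setUUr /= mulSn.
have := rank_submodular (W :|: Y i) (W :|: \bigcup_(j <- s) Y j).
have : rank W <= rank ((W :|: Y i) :&: (W :|: \bigcup_(j <- s) Y j)).
  by apply: rank_mono; rewrite -setUIr subsetUl.
by have := hY i; lia.
Qed.

(** * Tight separations and absorbing sets *)

Lemma tight_separation W : rank W < t ->
  exists F, [/\ F \in T, W \subset vset F.1, order F = rank W &
    forall S, S \in T -> W \subset vset S.1 -> order S <= rank W ->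
      #|vset F.2| <= #|vset S.2|].
Proof.
move=> rt; have [S0 [S0T WS0 oS0]] := rank_attained rt.
pose P S := [&& S \in T, W \subset vset S.1 & order S <= rank W].
have PS0 : P S0 by rewrite /P S0T WS0 oS0 leqnn.
case: (arg_minnP (fun S => #|vset S.2|) PS0) => F /and3P[FT WF oF] minF.
exists F; split=> //.
  by apply/eqP; rewrite eqn_leq oF rank_le_order.
by move=> S ST WS oS; apply: minF; rewrite /P ST WS oS.
Qed.

(** Join an optimal separation for [W :|: Y] with [F]. The meet still has [W] in its small side, so
    its order is at least that of [F], and by modularity the join costs nothing. *)
Lemma separation_beyond F W Y : F \in T -> W \subset vset F.1 ->
  order F = rank W -> rank (W :|: Y) < t ->
  exists S, [/\ S \in T, W :|: Y \subset vset S.1, order S = rank (W :|: Y),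
    vset F.1 \subset vset S.1 & vset S.2 \subset vset F.2].
Proof.
move=> FT WF oF rt; have [S [ST WYS oS]] := rank_attained rt.
have [sF _] := tangle_sep hT FT; have [sS _] := tangle_sep hT ST.
have meet_ge : rank W <= order (sep_meet F S).
  apply: rank_le_meet => //; rewrite subsetI WF.
  by apply: subset_trans WYS; apply: subsetUl.
have join_le : order (sep_join F S) <= rank (W :|: Y).
  by have := order_modular sF sS; lia.
have jT : sep_join F S \in T by apply: tangle_join => //; lia.
have WYj : W :|: Y \subset vset (sep_join F S).1.
  by apply: subset_trans WYS (subsetUr _ _).
exists (sep_join F S); split=> //.
- by apply/eqP; rewrite eqn_leq join_le rank_le_order.
- exact: subsetUl.
- exact: subsetIl.
Qed.

(** The large side of the meet is a union inside that of [F] which misses [z]; a meet of order at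
    most [rank W] would contradict the minimality of [F]. *)
Lemma meet_order_gt F S S' W z :
  rank W < t ->
  (forall R, R \in T -> W \subset vset R.1 -> order R <= rank W ->
     #|vset F.2| <= #|vset R.2|) ->
  S \in T -> S' \in T -> W \subset vset S.1 -> W \subset vset S'.1 ->
  vset S.2 \subset vset F.2 -> vset S'.2 \subset vset F.2 ->
  z \in vset F.2 -> z \notin vset S.2 -> z \notin vset S'.2 ->
  rank W < order (sep_meet S S').
Proof.
move=> rt minF ST S'T WS WS' SF S'F zF zS zS'.
rewrite ltnNge; apply/negP => om.
have mT : sep_meet S S' \in T by apply: tangle_meet => //; lia.
have Wm : W \subset vset (sep_meet S S').1 by rewrite /= subsetI WS.
have := minF _ mT Wm om; apply/negP; rewrite -ltnNge; apply: proper_card.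
rewrite properE /= subUset SF S'F /=.
by apply/subsetPn; exists z => //; rewrite inE negb_or zS.
Qed.

Lemma boundary_excess F S Z d :
  vset F.1 \subset vset S.1 -> vset F.1 :&: vset F.2 \subset vset S.2 ->
  order S <= order F + d -> vset F.1 :&: vset F.2 \subset Z ->
  #|vset S.1 :&: vset S.2 :\: Z| <= d.
Proof.
move=> FS FS2 oS FZ.
apply: leq_trans (subset_leq_card (setDS _ FZ)) _.
have FS' : vset F.1 :&: vset F.2 \subset vset S.1 :&: vset S.2.
  by rewrite subsetI FS2 (subset_trans (subsetIl _ _) FS).
by rewrite cardsD (setIidPr FS') leq_subLR.
Qed.

Lemma absorbing_set k d W : d < k -> rank W * k.+1 ^ d + d < t ->
  exists Z, #|Z| <= rank W * k.+1 ^ d /\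
    forall Y, rank (W :|: Y) <= rank W + d ->
      exists S, [/\ S \in T, Y \subset vset S.1 &
                    #|vset S.1 :&: vset S.2 :\: Z| < k].
Proof.
elim: d W => [|d IH] W dk hW.
  rewrite expn0 muln1 in hW *.
  have rt : rank W < t by lia.
  have [F [FT WF oF minF]] := tight_separation rt.
  exists (vset F.1 :&: vset F.2); split; first by rewrite -oF.
  move=> Y rY; have rYt : rank (W :|: Y) < t by lia.
  have [S [ST WYS oS FS SF]] := separation_beyond FT WF oF rYt.
  have [WS YS] : W \subset vset S.1 /\ Y \subset vset S.1.
    by apply/andP; rewrite -subUset.
  exists S; split=> //; apply: leq_ltn_trans dk.
  apply: (boundary_excess FS) => //; last by lia.
  (* With no excess, [S] itself competes with [F], so minimality forces equal large sides and no
     boundary vertex is lost. *)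
  have -> : vset S.2 = vset F.2.
    by apply/eqP; rewrite eqEcard SF minF //; lia.
  exact: subsetIr.
have rkd : rank W <= rank W * k.+1 ^ d.+1 by rewrite leq_pmulr // expn_gt0.
have rt : rank W < t by lia.
have [F [FT WF oF minF]] := tight_separation rt.
pose bd := vset F.1 :&: vset F.2.
(* Optimality for its own small side lets the order of [S] be read as a rank. *)
pose loses z S := [&& S \in T, vset F.1 \subset vset S.1,
  vset S.2 \subset vset F.2, order S == rank (vset S.1),
  order S <= rank W + d.+1 & z \notin vset S.2].
(* If nothing loses [z], the default [set0] adds nothing to [U]. *)
pose P z := if [pick S | loses z S] is Some R then vset R.1 else set0.
pose U := W :|: \bigcup_(z <- enum bd) P z.
have rP z : rank (W :|: P z) <= rank W + d.+1.
  rewrite /P; case: pickP => [S /and5P[ST FS _ /eqP oS /andP[oSd _]]|_].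
    by rewrite (setUidPr (subset_trans WF FS)) -oS.
  by rewrite setU0 leq_addr.
(* There are [rank W] boundary vertices, each raising the rank by at most [d.+1], and [d.+2 <= k].
   With the boundary itself put into [Z], this gives one factor [k.+1] per level. *)
have rU : rank U <= rank W * k.
  have := rank_bigcup (enum bd) rP; rewrite -/U -cardE.
  have -> : #|bd| = rank W by rewrite -oF.
  by move=> /leq_trans; apply; rewrite -mulnS leq_mul2l dk orbT.
have hU : rank U * k.+1 ^ d <= rank W * k * k.+1 ^ d by rewrite leq_mul2r rU orbT.
have eW : rank W * k.+1 ^ d.+1 = rank W * k.+1 ^ d + rank W * k * k.+1 ^ d.
  by rewrite expnS mulSn mulnDr mulnA.
have rkd' : rank W <= rank W * k.+1 ^ d by rewrite leq_pmulr // expn_gt0.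
have [|Z' [cZ' hZ']] := IH U (ltnW dk); first by lia.
exists (bd :|: Z'); split.
  apply: leq_trans (leq_card_setU _ _) _.
  have : #|bd| = rank W by rewrite -oF.
  by lia.
move=> Y rY; have rYt : rank (W :|: Y) < t by lia.
have [S [ST WYS oS FS SF]] := separation_beyond FT WF oF rYt.
have [WS YS] : W \subset vset S.1 /\ Y \subset vset S.1.
  by apply/andP; rewrite -subUset.
have [bdS|] := boolP (bd \subset vset S.2).
  exists S; split=> //; apply: leq_ltn_trans dk.
  by apply: (boundary_excess FS bdS); rewrite ?subsetUl // oS oF.
case/subsetPn => z zbd zS.
have lzS : loses z S.
  rewrite /loses ST FS SF zS oS rY eqn_leq rank_mono //= andbT.
  by rewrite -oS rank_le_order.
have [S0 PzE /and5P[S0T FS0 S0F /eqP oS0 /andP[oS0d zS0]]] :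
    exists2 S0, P z = vset S0.1 & loses z S0.
  by rewrite /P; case: pickP => [S0 ?|/(_ S)]; [exists S0 | rewrite lzS].
have WS0 := subset_trans WF FS0.
have zF : z \in vset F.2 by case/setIP: zbd.
have mgt := meet_order_gt rt minF S0T ST WS0 WS S0F SF zF zS0 zS.
have [sS _] := tangle_sep hT ST; have [sS0 _] := tangle_sep hT S0T.
have jle : rank (vset S0.1 :|: Y) <= order (sep_join S0 S).
  by apply: rank_le_join => //; apply: setUS.
have S0U : vset S0.1 \subset U.
  rewrite -PzE /U; apply: subset_trans (subsetUr _ _).
  by rewrite big_enum; apply: bigcup_sup.
(* As the meet has order above [rank W], the join has order at most [order S0 + d]. So [Y] raises
   the rank of [vset S0.1] by at most [d], and by submodularity also that of the larger set [U]. *)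
have [|S1 [S1T YS1 cS1]] := hZ' Y.
  have := rank_submodular U (vset S0.1 :|: Y).
  rewrite setUA (setUidPl S0U).
  have : rank (vset S0.1) <= rank (U :&: (vset S0.1 :|: Y)).
    by apply: rank_mono; rewrite subsetI S0U subsetUl.
  by move: (order_modular sS0 sS) mgt jle oS rY oS0; clear; lia.
exists S1; split=> //; apply: leq_ltn_trans cS1.
by apply: subset_leq_card; apply: setDS; apply: subsetUr.
Qed.

(** Adding [Z] to both sides of [S] keeps the order below [t]; deleting [Z] then leaves only the
    boundary vertices of [S] outside [Z]. *)
Lemma not_free_tangle_del S Z Y : S \in T -> Y \subset vset S.1 ->
  #|vset S.1 :&: vset S.2 :\: Z| < #|Y| -> #|Z| + #|Y| <= t ->
  Y :&: Z = set0 -> ~ free_wrt (tangle_del (whole G) T Z) Y.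
Proof.
move=> ST YS oS Zt YZ; apply; pose R := sep_add S Z.
have RT : R \in T by apply: tangle_add => //; rewrite order_add; lia.
have [/separationP[v e dj] _] := tangle_sep hT RT.
exists (gdel R.1 Z, gdel R.2 Z); split.
- rewrite inE; apply/andP; split.
    apply/separationP; split; rewrite /=.
    + by rewrite -setDUl -/(vset _) v.
    + apply/setP => x; move/setP/(_ x): e; rewrite !inE => /= e.
      by rewrite -andb_orl e.
    + rewrite -setI_eq0; apply/eqP/setP => x.
      move: dj; rewrite -setI_eq0 => /eqP/setP/(_ x).
      by rewrite !inE => dj; rewrite andbACA dj.
  apply/exists_inP; exists R => //; rewrite !eqxx !andbT.
  by apply/subsetP => x xZ; rewrite !inE xZ !orbT.
- apply: leq_ltn_trans oS; apply: subset_leq_card; apply/subsetP => x.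
  by rewrite !inE; do 3!case: (_ \in _).
- apply/subsetP => x xY; rewrite !inE (subsetP YS) //= andbT.
  by apply/negP => xZ; move/setP/(_ x): YZ; rewrite !inE xY xZ.
Qed.

End TangleRank.

(** * Choice of the subfamily *)

Lemma family_unionP (G : graph) (J : Type) (X : J -> {set vertex G}) J' v :
  reflect (exists2 j, J' j & v \in X j) (v \in family_union X J').
Proof. by rewrite inE; apply: asboolP. Qed.

Lemma maximal_free_subfamily (G : graph) (T : {set subgraph G * subgraph G})
    (J : Type) (X : J -> {set vertex G}) :
  exists J' : J -> Prop,
    [/\ forall j j', J' j -> J' j' -> j <> j' -> X j :&: X j' = set0,
        free_wrt T (family_union X J') &
        forall j, X j <> set0 -> X j :&: family_union X J' = set0 ->
          ~ free_wrt T (family_union X J' :|: X j)].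
Proof.
pose good (J' : J -> Prop) :=
  (forall j j', J' j -> J' j' -> j <> j' -> X j :&: X j' = set0) /\
  free_wrt T (family_union X J').
(* The size of the union is maximised, not that of [J']: it is bounded even when [J] is infinite. *)
pose P n := `[< exists2 J', good J' & #|family_union X J'| = n >].
have exP : exists n, P n.
  exists #|family_union X (fun=> False)|; apply/asboolP.
  exists (fun=> False) => //; split=> // -[S [_ + _]].
  suff -> : family_union X (fun=> False) = set0 by rewrite cards0.
  by apply/setP => v; rewrite in_set0; apply/negP => /family_unionP[].
have ubP n : P n -> n <= #|vertex G| by move=> /asboolP[J' _ <-]; apply: max_card.
case: (ex_maxnP exP ubP) => n /asboolP[J' [dis free] cn] maxn.
exists J'; split=> // j Xj0 XjJ' freej.
pose K i := J' i \/ i = j.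
have XK : family_union X K = family_union X J' :|: X j.
  apply/setP => v; rewrite [RHS]inE; apply/family_unionP/orP.
    by case=> i [J'i|->] vi; [left; apply/family_unionP; exists i | right].
  by case=> [/family_unionP[i J'i vi]|vj]; [exists i; [left|] | exists j; [right|]].
have disj i : J' i -> X i :&: X j = set0.
  move=> J'i; apply/setP => v; rewrite in_set0; apply/negP => /setIP[vi vj].
  have : v \in X j :&: family_union X J'.
    by rewrite inE vj; apply/family_unionP; exists i.
  by rewrite XjJ' inE.
have PK : P #|family_union X K|.
  apply/asboolP; exists K => //; split; last by rewrite XK.
  move=> i i' [J'i|->] [J'i'|->] ne //; first exact: dis.
  - exact: disj.
  - by rewrite setIC; apply: disj.
have := maxn _ PK; rewrite XK cardsU setIC XjJ' cards0 subn0 -cn.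
by rewrite -{2}[#|family_union X J'|]addn0 leq_add2l leqn0 cards_eq0 => /eqP.
Qed.

(** * Assembling the bounds *)

Theorem theorem5 (G : graph) (t : nat)
    (T : {set subgraph G * subgraph G}) (hT : tangle (whole G) t T)
    (k w : nat) (hk : 0 < k) (hw : 0 < w) (ht : (k + w) ^ k.+1 + k <= t)
    (J : Type) (X : J -> {set vertex G}) (hX : forall j, #|X j| = k) :
  exists J' : J -> Prop,
    [/\ forall j j', J' j -> J' j' -> j <> j' -> X j :&: X j' = set0,
        free_wrt T (family_union X J') &
        #|family_union X J'| < w ->
        exists Z : {set vertex G},
          [/\ family_union X J' \subset Z,
              #|Z| <= (w + k) ^ k.+1 &
              forall j, X j :&: Z <> set0 \/
                        ~ free_wrt (tangle_del (whole G) T Z) (X j)]].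
Proof.
have [J' [dis free maxJ']] := maximal_free_subfamily T X.
exists J'; split=> // ltw; set W := family_union X J' in free maxJ' ltw *.
have rW : rank t T W <= #|W| := rank_le_card hT W.
have bound : w * k.+1 ^ k <= (w + k) ^ k.+1.
  by rewrite expnS leq_mul ?leq_addr // leq_exp2r //; lia.
have k1E : k.+1 ^ k = k.+1 * k.+1 ^ k.-1 by rewrite -expnS prednK.
have pos : 0 < k.+1 ^ k.-1 by rewrite expn_gt0.
(* Room for [W] next to the absorbing set: one of the [k.+1] copies of [w * k.+1 ^ k.-1] pays for
   [W]. *)
have bound' : #|W| + rank t T W * k.+1 ^ k.-1 <= w * k.+1 ^ k.
  have w1 : #|W| <= w * k.+1 ^ k.-1.
    by apply: leq_trans (ltnW ltw) _; rewrite leq_pmulr.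
  have w2 : rank t T W * k.+1 ^ k.-1 <= w * k.+1 ^ k.-1.
    by rewrite leq_mul2r; apply/orP; right; lia.
  rewrite k1E mulSn mulnDr; apply: leq_add => //.
  apply: leq_trans w2 _; rewrite leq_mul2l; apply/orP; right.
  by rewrite leq_pmull.
rewrite [k + w]addnC in ht.
have k1 : k.-1 < k by rewrite prednK.
have [|Z [cZ hZ]] := absorbing_set hT (W := W) k1; first by lia.
have cWZ : #|W :|: Z| <= (w + k) ^ k.+1.
  by apply: leq_trans (leq_card_setU _ _) _; lia.
exists (W :|: Z); split=> //; first exact: subsetUl.
move=> j; have [XjZ|/eqP] := eqVneq (X j :&: (W :|: Z)) set0; last by left.
right.
have /(maxJ' j) nfree : X j <> set0.
  by move=> X0; have := hX j; rewrite X0 cards0; lia.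
have XjW : X j :&: W = set0.
  by apply/eqP; rewrite -subset0 -XjZ setIS ?subsetUl.
have cWX : #|W :|: X j| = #|W| + k.
  by rewrite cardsU setIC XjW cards0 subn0 hX.
(* Freeness of [W] makes it independent, so non-freeness of [W :|: X j] bounds its rank by
   [#|W| + k - 1], an excess of at most [k.-1]. *)
have rWge : #|W| <= rank t T W.
  rewrite leqNgt; apply/negP => lt; apply: free.
  have [|S [ST WS oS]] := @rank_attained _ t T W; first by lia.
  by exists S; rewrite oS.
have rWX : rank t T (W :|: X j) <= rank t T W + k.-1.
  have /contrapT[S [ST oS WXS]] := nfree XjW.
  by apply: leq_trans (rank_le_order t ST WXS) _; lia.
have [S [ST XS oS]] := hZ _ rWX.
(* The summand [k] in [ht] leaves room for [X j] beside [W :|: Z]. *)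
apply: (not_free_tangle_del hT ST XS); rewrite ?hX //; last by lia.
apply: leq_ltn_trans oS; apply: subset_leq_card; apply: setDS.
exact: subsetUr.
Qed.
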